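(* Let $\mathbf{F}\in k[\mathbf{z}]^{l\times m}$ have rank $r$, where $1\le r<l$, and let $c_1,\ldots,c_\xi$ be all the $r\times r$ column reduced minors of $\mathbf{F}$. Let $\mathcal{K}=\rho(\mathbf{F})$, $d=d_r(\mathbf{F})$, and let $f$ be a divisor of $d$. Let $M(f)=\{h\in k[\mathbf{z}] : f\mid h \text{ and } h\mid d\}$, where polynomials differing by a nonzero constant factor are identified. Suppose that every $h\in M(f)$ satisfies $\gcd(h,\frac{d}{h})=1$ and that $\langle c_1,\ldots,c_\xi\rangle=k[\mathbf{z}]$. Then the following are equivalent: 1. $\mathbf{F}$ has an FLP factorization with respect to $f$; 2. $\mathcal{K}:f$ is a free module of rank $r$, but $\mathcal{K}:h$ is not a free module of rank $r$ for every $h\in M(f)\setminus\{f\}$.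
   Context: Standing assumptions: $k$ is an algebraically closed field, $\mathbf{z}=(z_1,\ldots,z_n)$ with $n\ge 3$, $k[\mathbf{z}]$ is the polynomial ring, $k[\mathbf{z}]^{l\times m}$ is the set of $l\times m$ matrices over $k[\mathbf{z}]$, and $l\le m$. Greatest common divisors are determined up to a nonzero constant in $k$; equalities involving them are understood up to such constants. Notation: $\rho(\mathbf{F})$ is the submodule of $k[\mathbf{z}]^{1\times m}$ generated by the rows of $\mathbf{F}$. For $1\le i\le \mathrm{rank}(\mathbf{F})$, $d_i(\mathbf{F})$ is the gcd of all $i\times i$ minors of $\mathbf{F}$. For a submodule $\mathcal{K}\subseteq k[\mathbf{z}]^{1\times m}$ and $f\in k[\mathbf{z}]$, $\mathcal{K}:f=\{\vec u\in k[\mathbf{z}]^{1\times m} : f\vec u\in\mathcal{K}\}$. Column reduced minors: for a matrix $\mathbf{A}$ of rank $r$, the $r\times r$ reduced minors of $\mathbf{A}$ are the $r\times r$ minors of $\mathbf{A}$, each divided by $d_r(\mathbf{A})$. If $\mathbf{F}\in k[\mathbf{z}]^{l\times m}$ has rank $r$ with $1\le r<l$, choose any full column rank submatrix $\bar{\mathbf{F}}\in k[\mathbf{z}]^{l\times r}$ of $\mathbf{F}$ (formed by $r$ columns of $\mathbf{F}$); the $r\times r$ column reduced minors $c_1,\ldots,c_\xi$ of $\mathbf{F}$, $\xi=\binom{l}{r}$, are the $r\times r$ reduced minors of $\bar{\mathbf{F}}$ (up to a common nonzero constant they do not depend on the choice of $\bar{\mathbf{F}}$). Factorizations: for $f$ a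 divisor of $d_r(\mathbf{F})$, a factorization of $\mathbf{F}$ with respect to $f$ is an equation $\mathbf{F}=\mathbf{G}_1\mathbf{F}_1$ with $\mathbf{G}_1\in k[\mathbf{z}]^{l\times r}$, $\mathbf{F}_1\in k[\mathbf{z}]^{r\times m}$ and $d_r(\mathbf{G}_1)=f$. It is an FLP factorization if moreover $\mathbf{F}_1$ is factor left prime (FLP): a full row rank matrix $\mathbf{F}_1\in k[\mathbf{z}]^{r\times m}$ is FLP if, for every factorization $\mathbf{F}_1=\mathbf{A}\mathbf{B}$ with $\mathbf{A}\in k[\mathbf{z}]^{r\times r}$ and $\mathbf{B}\in k[\mathbf{z}]^{r\times m}$, the matrix $\mathbf{A}$ is unimodular, i.e. $\det(\mathbf{A})$ is a nonzero constant. *)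

(* Defs.v *)
From HB Require Import structures.
From mathcomp Require Export all_boot all_order all_algebra.
From mathcomp.multinomials Require Export mpoly.

Set Implicit Arguments.
Unset Strict Implicit.
Unset Printing Implicit Defensive.

Export GRing.Theory.
Local Open Scope ring_scope.

Section Gcd.
Variable R : comNzRingType.

Definition divides (a b : R) : Prop := exists q, b = q * a.

(* A gcd is only determined up to a unit, so it is a relation: [is_gcd S g]
   says that g is one of the gcds of the set S. *)
Definition is_gcd (S : R -> Prop) (g : R) : Prop :=
  (forall x, S x -> divides g x) /\
  (forall e, (forall x, S x -> divides e x) -> divides e g).

Definition coprime_pair (a b : R) : Prop := is_gcd (fun x => x = a \/ x = b) 1.

Definition ideal_gen (I : finType) (c : I -> R) (h : R) : Prop :=
  exists a : I -> R, h = \sum_i a i * c i.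

End Gcd.

(* Strictly increasing maps 'I_i -> 'I_N; each one is a choice of i of the N
   indices, so there are 'C(N, i) of them. *)
Definition selection (i N : nat) : finType :=
  {s : {ffun 'I_i -> 'I_N} |
    [forall a : 'I_i, forall b : 'I_i, (a < b)%N ==> (s a < s b)%N]}.

Definition sel_fun (i N : nat) (s : selection i N) : 'I_i -> 'I_N := val s.

Section Minors.
Variable R : comNzRingType.

Definition minor (l m i : nat) (A : 'M[R]_(l, m))
    (s : selection i l) (t : selection i m) : R :=
  \det (mxsub (sel_fun s) (sel_fun t) A).

Definition is_gcd_minors (l m : nat) (i : nat) (A : 'M[R]_(l, m)) (g : R) : Prop :=
  is_gcd (fun x => exists s : selection i l, exists t : selection i m,
                     x = minor A s t) g.

End Minors.

Definition rank_frac (R : idomainType) (l m : nat) (A : 'M[R]_(l, m)) : nat :=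
  \rank (map_mx (@tofrac R) A).

(* The selection t gives the full column rank l x r submatrix, and e is the gcd
   of its r x r minors; c is determined up to a common unit, which accounts for
   the freedom in t and e. *)
Definition column_reduced_minors (R : idomainType) (l m r : nat)
    (F : 'M[R]_(l, m)) (c : selection r l -> R) : Prop :=
  exists t : selection r m, exists e : R,
    let Fbar := colsub (sel_fun t) F in
    [/\ rank_frac Fbar = r,
        is_gcd_minors r Fbar e &
        forall s : selection r l, \det (rowsub (sel_fun s) Fbar) = c s * e].

Section Submodules.
Variable R : comNzRingType.

Definition row_module (l m : nat) (F : 'M[R]_(l, m)) (u : 'rV[R]_m) : Prop :=
  exists a : 'rV[R]_l, u = a *m F.

Definition colon (m : nat) (K : 'rV[R]_m -> Prop) (f : R) (u : 'rV[R]_m) : Prop :=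
  K (f *: u).

(* The rows of B form a basis of K. *)
Definition free_of_rank (m : nat) (K : 'rV[R]_m -> Prop) (r : nat) : Prop :=
  exists B : 'M[R]_(r, m),
    (forall a : 'rV[R]_r, a *m B = 0 -> a = 0) /\
    (forall u : 'rV[R]_m, K u <-> row_module B u).

End Submodules.

Section Factorizations.
Variables (k : fieldType) (n : nat).
Local Notation R := {mpoly k[n]}.

Definition associated (p q : R) : Prop := exists2 a : k, a != 0 & p = a *: q.

Definition unimodular (r : nat) (A : 'M[R]_r) : Prop :=
  exists2 a : k, a != 0 & \det A = a%:MP.

Definition factor_left_prime (r m : nat) (F1 : 'M[R]_(r, m)) : Prop :=
  rank_frac F1 = r /\
  forall (A : 'M[R]_r) (B : 'M[R]_(r, m)), F1 = A *m B -> unimodular A.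

Definition is_factorization (l m r : nat) (F : 'M[R]_(l, m)) (f : R)
    (G1 : 'M[R]_(l, r)) (F1 : 'M[R]_(r, m)) : Prop :=
  F = G1 *m F1 /\ is_gcd_minors r G1 f.

Definition has_FLP_factorization (l m : nat) (r : nat) (F : 'M[R]_(l, m)) (f : R) : Prop :=
  exists G1 : 'M[R]_(l, r), exists F1 : 'M[R]_(r, m),
    is_factorization F f G1 F1 /\ factor_left_prime F1.

(* M(f), as the set of all polynomial representatives of its classes modulo
   [associated]. *)
Definition M_set (d f h : R) : Prop := divides f h /\ divides h d.

End Factorizations.

(* Main.v *)
Require Import Defs.
From mathcomp Require Import perm.
Set Implicit Arguments.
Unset Strict Implicit.
Unset Printing Implicit Defensive.
Import Pdiv.Idomain.
Local Open Scope ring_scope.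

(** Suppose [F = G *m B] with [G] of size [l x r].  The [r x r] minors of [G] are
    proportional to the column reduced minors, so, these being comaximal, they
    generate a principal ideal [(f')] and Cramer's rule gives [X *m G = f'%:M].
    Hence [f' rho(B)] is contained in [rho(F)], and when [f'] is coprime to
    [d / f'] one even gets [K : f' = rho(B)].  Conversely, if [K : (g f')] is
    contained in [rho(B)], then multiplication by [B] is injective modulo [g],
    whereas [g] divides all maximal minors of [B]; by McCoy's theorem [g] is a
    unit.  Coprimality is exploited through Gauss's lemma, which makes [k[z]] a GCD
    domain by induction on the number of variables. *)

(** * Divisibility in a commutative ring *)

Section Divides.
Variable R : comNzRingType.
Implicit Types a b x y : R.

Lemma divides_refl a : divides a a.
Proof. by exists 1; rewrite mul1r. Qed.

Lemma divides0 a : divides a 0.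
Proof. by exists 0; rewrite mul0r. Qed.

Lemma divides_trans a b x : divides a b -> divides b x -> divides a x.
Proof. by move=> [q ->] [s ->]; exists (s * q); rewrite mulrA. Qed.

Lemma divides_mull a b x : divides a b -> divides a (x * b).
Proof. by move=> [q ->]; exists (x * q); rewrite mulrA. Qed.

Lemma divides_mulr a b x : divides a b -> divides a (b * x).
Proof. by rewrite mulrC; apply: divides_mull. Qed.

Lemma dividesD a x y : divides a x -> divides a y -> divides a (x + y).
Proof. by move=> [q ->] [s ->]; exists (q + s); rewrite mulrDl. Qed.

Lemma dividesN a x : divides a x -> divides a (- x).
Proof. by move=> [q ->]; exists (- q); rewrite mulNr. Qed.

Lemma divides_sum (I : Type) (s : seq I) (P : pred I) (E : I -> R) a :
  (forall i, P i -> divides a (E i)) -> divides a (\sum_(i <- s | P i) E i).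
Proof.
by move=> h; elim/big_ind: _ => //; [apply: divides0 | apply: dividesD].
Qed.

Lemma divides_mul a b x y : divides a x -> divides b y -> divides (a * b) (x * y).
Proof. by move=> [q ->] [s ->]; exists (q * s); rewrite mulrACA. Qed.

Lemma divides_mul_unit a b x : divides a 1 -> divides (a * b) x <-> divides b x.
Proof.
move=> a1; split; first by apply: divides_trans; apply/divides_mull/divides_refl.
by move=> bx; rewrite -[x]mul1r; apply: divides_mul.
Qed.

End Divides.

Lemma divides_cancel (R : idomainType) (x a b : R) :
  x != 0 -> divides (a * x) (b * x) -> divides a b.
Proof. by move=> x0 [q]; rewrite mulrA => /(mulIf x0) ->; exists q. Qed.

(** * GCD domains and Gauss's lemma *)

Definition gcd_domain (R : idomainType) : Prop :=
  forall a b : R, exists g, is_gcd (fun x => x = a \/ x = b) g.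

Section GcdDomain.
Variable R : idomainType.
Hypothesis gcdR : gcd_domain R.
Implicit Types (a b c x y g : R) (p q s e : {poly R}).

Lemma gcd_seq (t : seq R) : exists g, is_gcd (fun x => x \in t) g.
Proof.
elim: t => [|a t [g [gt gmax]]].
  by exists 0; split=> // e _; apply: divides0.
have [h [hag hmax]] := gcdR a g; exists h; split=> [x|e he].
  rewrite inE => /orP[/eqP ->|/gt]; first by apply: hag; left.
  by apply: divides_trans; apply: hag; right.
apply: hmax => x [->|->]; first by apply: he; rewrite inE eqxx.
by apply: gmax => y yt; apply: he; rewrite inE yt orbT.
Qed.

(** Multiplication by [x] commutes with gcds: a gcd [h] of the multiples [x * y] has the form
    [q * x], and [q] divides every [y], hence [g]. The list [t] makes [S] finite, so that [h]
    exists. *)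
Lemma divides_mul_gcd (S : R -> Prop) (t : seq R) g a x :
    (forall y, S y <-> y \in t) -> is_gcd S g ->
  (forall y, S y -> divides a (x * y)) -> divides a (x * g).
Proof.
move=> St [_ gmax] ha; have [->|x0] := eqVneq x 0.
  by rewrite mul0r; apply: divides0.
have [h [ht hmax]] := gcd_seq [seq x * y | y <- t].
have /hmax[q hq]: forall z, z \in [seq x * y | y <- t] -> divides x z.
  by move=> _ /mapP[y _ ->]; apply/divides_mulr/divides_refl.
have: divides a h.
  by apply: hmax => _ /mapP[y /St yt ->]; apply: ha.
move/divides_trans; apply; rewrite hq [x * g]mulrC.
apply: divides_mul (divides_refl x); apply: gmax => y Sy.
apply: (@divides_cancel _ x) => //; rewrite -hq [y * x]mulrC.
by apply: ht; apply: map_f; apply/St.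
Qed.

Lemma divides_mul_gcd2 a b g c x : is_gcd (fun y => y = a \/ y = b) g ->
  divides c (x * a) -> divides c (x * b) -> divides c (x * g).
Proof.
move=> hg ca cb; apply: (divides_mul_gcd (t := [:: a; b]) _ hg).
  by move=> y; rewrite !inE; split=> [[]->|/orP[]/eqP->];
    rewrite ?eqxx ?orbT //; [left | right].
by move=> y [->|->].
Qed.

Lemma coprime_divides a b x : coprime_pair a b -> divides a (x * b) -> divides a x.
Proof.
move=> ab ha; rewrite -[x]mulr1; apply: divides_mul_gcd2 ab _ ha.
exact/divides_mull/divides_refl.
Qed.

(** With [g] a gcd of [c] and [x], [c] divides both [y * c] and [y * x], hence [y * g]; the quotient
    of [c] by [g] therefore divides [y]. *)
Lemma gcd_domain_primal c x y : divides c (x * y) ->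
  exists c1 c2, [/\ c = c1 * c2, divides c1 x & divides c2 y].
Proof.
move=> cxy; have [g hg] := gcdR c x.
have gc : divides g c by apply: hg.1; left.
have gx : divides g x by apply: hg.1; right.
have cyg : divides c (y * g).
  apply: divides_mul_gcd2 hg _ _; last by rewrite mulrC.
  exact/divides_mull/divides_refl.
(* A zero [g] cannot be cancelled, but it forces [c] and [x] to vanish, and [0 * 1] is then a
   splitting. *)
case: gc => q cq; have [g0|g0] := eqVneq g 0.
  rewrite g0 in cq gx; exists 0, 1.
  by split=> //; [rewrite cq mulr0 mul0r | exists y; rewrite mulr1].
exists g, q; split=> //; first by rewrite mulrC.
by apply: (divides_cancel g0); rewrite -cq.
Qed.

Lemma divides_polyC c p : divides c%:P p <-> forall i, divides c p`_i.
Proof.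
split=> [[q -> i]|]; first by rewrite coefMC; exists q`_i.
elim/poly_ind: p => [|p a IHp] hc; first exact: divides0.
apply: dividesD.
  apply/divides_mulr/IHp => i; have := hc i.+1.
  by rewrite coefD coefMX coefC addr0.
have [q] := hc 0; rewrite coefD coefMX coefC add0r => ->.
by exists q%:P; rewrite polyCM.
Qed.

(** The content is the gcd of the coefficients; describing it by its divisors keeps coefficients out
    of the later arguments. *)
Lemma content_exists p :
  exists g, forall c, divides c%:P p <-> divides c g.
Proof.
have [g [gp gmax]] := gcd_seq p; exists g => c; split=> [/divides_polyC cp|cg].
  by apply: gmax => _ /(nthP 0)[i _ <-].
apply/divides_polyC => i; have [lt_ip|le_pi] := ltnP i (size p).
  by apply: divides_trans cg _; apply/gp/mem_nth.
by rewrite nth_default //; apply: divides0.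
Qed.

Definition primitive p := forall c, divides c%:P p -> divides c 1.

Lemma primitive_part p : p != 0 -> exists g p',
  [/\ p = g%:P * p', primitive p' & forall c, divides c%:P p <-> divides c g].
Proof.
move=> p0; have [g hg] := content_exists p.
have [p' def_p] : divides g%:P p by apply/hg/divides_refl.
exists g, p'; split=> // [|c cp']; first by rewrite mulrC.
have g0 : g != 0 by apply: contraNneq p0 => g0; rewrite def_p g0 mulr0.
apply: (divides_cancel g0); rewrite mul1r; apply/hg.
by rewrite def_p polyCM; apply: divides_mul (divides_refl _).
Qed.

(* Split [c] along the product of the two leading coefficients and drop the
   leading term on either side. *)
Lemma gauss_unit p q c :
    (forall x, divides x c -> divides x%:P p -> divides x 1) ->
    (forall x, divides x c -> divides x%:P q -> divides x 1) ->
  divides c%:P (p * q) -> divides c 1.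
Proof.
have [N] := ubnP (size p + size q); elim: N p q c => // N IHN p q c ltN cp cq cpq.
have [p0|p0] := eqVneq p 0.
  by apply: cp; rewrite ?p0; [apply: divides_refl | apply: divides0].
have [q0|q0] := eqVneq q 0.
  by apply: cq; rewrite ?q0; [apply: divides_refl | apply: divides0].
have drop_lead s : s != 0 -> exists2 s' : {poly R}, (size s' < size s)%N &
    s = s' + (lead_coef s)%:P * 'X^((size s).-1).
  move=> s0; exists (take_poly (size s).-1 s).
    by rewrite (leq_ltn_trans (size_take_poly _ _)) // prednK // size_poly_gt0.
  rewrite -[LHS](poly_take_drop (size s).-1); congr (_ + _ * _).
  apply/polyP => i; rewrite coef_drop_poly coefC.
  case: i => [|i] /=; first by rewrite add0n.
  rewrite nth_default //; case: (size s) => // j.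
  by rewrite addSn ltnS leq_addl.
have : divides c (lead_coef p * lead_coef q).
  by rewrite -lead_coefM lead_coefE; apply: (divides_polyC _ _).1 cpq _.
move=> /gcd_domain_primal[c1 [c2 [def_c c1p c2q]]].
have c1c : divides c1 c by rewrite def_c; apply/divides_mulr/divides_refl.
have c2c : divides c2 c by rewrite def_c; apply/divides_mull/divides_refl.
have lift_polyC x y t : divides x y -> divides x%:P (y%:P * t).
  by move=> [z ->]; apply: divides_mulr; exists z%:P; rewrite polyCM.
(* Since [c1] divides the leading term of [p], deleting that term keeps [c1] a divisor of the
   product, and a divisor of [c1] that divides [p'] also divides [p]. The same holds for [c2] and
   [q]. *)
rewrite def_c -[1]mulr1; apply: divides_mul.
  have [p' ltp def_p] := drop_lead p p0.
  apply: (IHN p' q).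
  - by rewrite -ltnS (leq_trans _ ltN) // !ltnS ltn_add2r.
  - move=> x xc1 xp'; apply: cp; first exact: divides_trans c1c.
    rewrite def_p; apply: dividesD => //; apply: lift_polyC.
    exact: divides_trans c1p.
  - by move=> x xc1; apply/cq/(divides_trans xc1).
  have -> : p' * q = p * q + - ((lead_coef p)%:P * ('X^((size p).-1) * q)).
    by rewrite {1}def_p mulrDl mulrA addrK.
  apply/dividesD/dividesN/lift_polyC => //; apply: divides_trans cpq.
  by rewrite -[c1%:P]mulr1; have := lift_polyC c1 c 1 c1c; rewrite !mulr1.
have [q' ltq def_q] := drop_lead q q0.
apply: (IHN p q').
- by rewrite -ltnS (leq_trans _ ltN) // !ltnS ltn_add2l.
- by move=> x xc2; apply/cp/(divides_trans xc2).
- move=> x xc2 xq'; apply: cq; first exact: divides_trans c2c.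
  rewrite def_q; apply: dividesD => //; apply: lift_polyC.
  exact: divides_trans c2q.
have -> : p * q' = p * q + - ((lead_coef q)%:P * ('X^((size q).-1) * p)).
  by rewrite {1}def_q mulrDr [p * (_ * _)]mulrC -mulrA addrK.
apply/dividesD/dividesN/lift_polyC => //; apply: divides_trans cpq.
by have := lift_polyC c2 c 1 c2c; rewrite !mulr1.
Qed.

(** Divide [c] and [p] by the gcd [g] of [c] and the content of [p]. The cofactors [c1] and [p1]
    share only unit constants, so [gauss_unit] makes [c1] a unit. *)
Lemma gauss_divides c p q :
  c != 0 -> primitive q -> divides c%:P (p * q) -> divides c%:P p.
Proof.
move=> c0 prim_q cpq; have [a ha] := content_exists p.
have [g [gac gmax]] := gcdR c a.
have [c1 def_c] : divides g c by apply: gac; left.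
have ga : divides g a by apply: gac; right.
have g0 : g != 0 by apply: contraNneq c0 => g0; rewrite def_c g0 mulr0.
have /ha[p1 def_p] := ga.
suff c1_unit : divides c1 1.
  by apply/ha; rewrite def_c; apply/divides_mul_unit.
apply: (@gauss_unit p1 q) => [x xc1 xp1|x _|]; last 2 first.
- exact: prim_q.
- apply: (@divides_cancel _ g%:P); rewrite ?polyC_eq0 // -polyCM -def_c.
  by rewrite mulrAC -def_p.
apply: (divides_cancel g0); rewrite mul1r; apply: gmax => y [] ->.
  by rewrite def_c; apply: divides_mul (divides_refl _).
apply/ha; rewrite def_p polyCM; exact: divides_mul (divides_refl _).
Qed.

(** The relation [%|] gives only [c *: p = s * q] with [c] a nonzero constant; Gauss's lemma moves
    [c] into [s], where it cancels. *)
Lemma dvdp_primitive p q : primitive q -> q %| p -> divides q p.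
Proof.
move=> prim_q /dvdpP[[c s] /= c0 def_p].
have [t def_s] : divides c%:P s.
  apply: gauss_divides prim_q _ => //; rewrite -def_p -mul_polyC mulrC.
  by exists p.
exists t; apply: (@mulfI _ c%:P); first by rewrite polyC_eq0.
by rewrite mul_polyC def_p def_s mulrAC mulrC.
Qed.

End GcdDomain.

(** [gcdp] is a gcd only up to nonzero constants of [R]. Its primitive part [P], times a gcd [h] of
    the two contents, is a true gcd. *)
Lemma gcd_domain_poly (R : idomainType) : gcd_domain R -> gcd_domain {poly R}.
Proof.
move=> gcdR p q; have [G0|G0] := eqVneq (gcdp p q) 0.
  move/eqP: G0; rewrite gcdp_eq0 => /andP[/eqP -> /eqP ->].
  by exists 0; split=> [x []->|e _]; apply: divides0.
have [gG [P [def_G primP _]]] := primitive_part gcdR G0.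
have PG : P %| gcdp p q by rewrite def_G dvdp_mull.
have GP : gcdp p q %| P.
  apply: (@eq_dvdp _ gG 1); last by rewrite mul1r def_G mul_polyC.
  by apply: contraNneq G0 => g0; rewrite def_G g0 mul0r.
have [a ha] := content_exists gcdR p; have [b hb] := content_exists gcdR q.
have [h [hab hmax]] := gcdR a b.
have hp : divides h%:P p by apply/ha/hab; left.
have hq : divides h%:P q by apply/hb/hab; right.
have h0 : h != 0.
  apply: contraNneq G0 => h0; move: hp hq; rewrite h0 => -[s ->] [t ->].
  by rewrite !mulr0 gcd0p.
have hP t : divides h%:P t -> P %| t -> divides (h%:P * P) t.
  move=> ht /(dvdp_primitive gcdR primP)[s def_t].
  rewrite def_t; apply: divides_mul (divides_refl _).
  by apply: gauss_divides h0 primP _; rewrite -?def_t.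
exists (h%:P * P); split=> [x []->|e he].
- by apply: hP => //; apply: dvdp_trans PG (dvdp_gcdl _ _).
- by apply: hP => //; apply: dvdp_trans PG (dvdp_gcdr _ _).
have ep : divides e p by apply: he; left.
have eq : divides e q by apply: he; right.
have e0 : e != 0.
  apply: contraNneq G0 => e0; move: ep eq; rewrite e0 => -[s ->] [t ->].
  by rewrite !mulr0 gcd0p.
have [ce [e' [def_e prim_e' hce]]] := primitive_part gcdR e0.
have cee : divides ce%:P e by apply/hce/divides_refl.
have e'e : divides e' e by rewrite def_e; apply/divides_mull/divides_refl.
(* The content of [e] is compared with [h], and its primitive part with [P]. *)
rewrite def_e; apply: divides_mul.
  have [s ->] : divides ce h.
    apply: hmax => y [->|->]; [apply/ha | apply/hb]; exact: divides_trans cee _.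
  by exists s%:P; rewrite polyCM.
apply: dvdp_primitive => //; apply: dvdp_trans GP; rewrite dvdp_gcd.
have [[s ->] [t ->]] := (divides_trans e'e ep, divides_trans e'e eq).
by rewrite !dvdp_mull.
Qed.

Lemma gcd_domain_iso (A B : idomainType) (phi : {rmorphism A -> B})
    (psi : B -> A) :
  cancel phi psi -> cancel psi phi -> gcd_domain B -> gcd_domain A.
Proof.
move=> phiK psiK gcdB a b; have [g [gab gmax]] := gcdB (phi a) (phi b).
have gpsi x : divides g (phi x) -> divides (psi g) x.
  by move=> [q def_x]; exists (psi q); apply: (can_inj phiK); rewrite rmorphM !psiK.
exists (psi g); split=> [x []->|e he].
- by apply/gpsi/gab; left.
- by apply/gpsi/gab; right.
have ephi x : divides e x -> divides (phi e) (phi x).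
  by move=> [q ->]; exists (phi q); rewrite rmorphM.
have [q def_g] : divides (phi e) g.
  by apply: gmax => x [->|->]; apply/ephi/he; [left | right].
by exists (psi q); apply: (can_inj phiK); rewrite rmorphM !psiK.
Qed.

(** * Multivariate polynomials as iterated univariate ones *)

Section MPoly.
Variable k : fieldType.

(** The inverse of [muni], which singles out the last variable. *)
Definition mmulti_eval n (p : {poly {mpoly k[n]}}) : {mpoly k[n.+1]} :=
  (map_poly (@mwiden n k) p).['X_ord_max].

Lemma muniX n (m : 'X_{1..n.+1}) :
  muni ('X_[k, m]) =
  'X_[[multinom m (widen_ord (leqnSn n) i) | i < n]] *: 'X^(m ord_max).
Proof. by rewrite muniE msuppX big_seq1 mcoeffX eqxx scale1r. Qed.

Lemma muni_mwiden n (p : {mpoly k[n]}) : muni (mwiden p) = p%:P.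
Proof.
rewrite [p]mpolyE (raddf_sum (@mwiden n k : {additive _ -> _})).
rewrite (raddf_sum (@muni n k : {additive _ -> _})).
rewrite (raddf_sum (polyC : {additive _ -> _})) /=.
apply: eq_bigr => m _.
rewrite mwidenZ mwidenX muniZ muniX mnmwiden_ordmax expr0 -mul_mpolyC polyCM.
rewrite -!mul_polyC mulr1; congr (_ * _%:P); congr 'X_[_].
by apply/mnmP => i; rewrite mnmE mnmwiden_widen.
Qed.

Lemma muniK n : cancel (@muni n k) (@mmulti_eval n).
Proof.
move=> p; rewrite [p in RHS]mpolyE {1}[p]mpolyE /mmulti_eval.
rewrite (raddf_sum (@muni n k : {additive _ -> _})).
rewrite (raddf_sum (map_poly (@mwiden n k) : {additive _ -> _})) horner_sum /=.
apply: eq_bigr => m _; rewrite muniZ muniX.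
rewrite !map_polyZ /= map_polyXn !hornerZ hornerXn mwidenC mwidenX mul_mpolyC.
congr (_ *: _); rewrite mpolyXn -mpolyXD; congr 'X_[_].
apply/mnmP => i; rewrite mnmDE mulmnE mnm1E.
have [->|ne_i] := eqVneq i ord_max.
  by rewrite mnmwiden_ordmax mul1n.
have lt_in : (i < n)%N.
  rewrite ltn_neqAle -ltnS ltn_ord andbT; apply: contraNneq ne_i => eq_in.
  exact/eqP/val_inj.
have -> : i = widen_ord (leqnSn n) (Ordinal lt_in) by apply: val_inj.
by rewrite mnmwiden_widen mnmE mul0n addn0.
Qed.

Lemma mmulti_evalK n : cancel (@mmulti_eval n) (@muni n k).
Proof.
move=> p; rewrite /mmulti_eval.
elim/poly_ind: p => [|p a IHp]; first by rewrite rmorph0 horner0 raddf0.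
rewrite rmorphD rmorphM /= map_polyX map_polyC /= hornerD hornerM hornerX hornerC.
rewrite raddfD /= rmorphM /= IHp muni_mwiden; congr (_ * _ + _).
rewrite muniX mnm1E eqxx expr1 (_ : [multinom _ | i < n] = 0%MM) ?mpolyX0 ?scale1r //.
apply/mnmP => i; rewrite mnmE mnm1E mnm0E; apply/eqP; rewrite eqb0.
by rewrite -val_eqE /= neq_ltn ltn_ord orbT.
Qed.

Lemma gcd_domain_mpoly n : gcd_domain {mpoly k[n]}.
Proof.
elim: n => [|n IHn]; last first.
  exact: gcd_domain_iso (@muniK n) (@mmulti_evalK n) (gcd_domain_poly IHn).
(* Without variables the ring is the field [k], so [a] is a gcd of [a] and [b] when it is nonzero,
   and [b] is one otherwise. *)
have unit (p : {mpoly k[0]}) : p != 0 -> divides p 1.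
  move=> p0; have def_p : p = (p@_0)%:MP.
    apply/mpolyP => m; rewrite mcoeffC; have -> : m = 0%MM by apply/mnmP; case.
    by rewrite eqxx mulr1.
  have a0 : p@_0 != 0 by apply: contraNneq p0 => a0; rewrite def_p a0 mpolyC0.
  by exists (p@_0)^-1%:MP; rewrite {2}def_p -mpolyCM mulVf.
move=> a b; have [->|a0] := eqVneq a 0; last first.
  exists a; split=> [x|e]; last by apply; left.
  move=> _; rewrite -[x]mulr1; exact/divides_mull/unit.
exists b; split=> [x [->|->]|e]; [exact: divides0|exact: divides_refl|].
by apply; right.
Qed.

Lemma mpoly_divides1 n (p : {mpoly k[n]}) :
  divides p 1 -> exists2 a : k, a != 0 & p = a%:MP.
Proof.
move=> [q /esym/mpoly_intro_unit/andP[/eqP def_p]]; rewrite unitfE => a0.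
by exists p@_0.
Qed.

End MPoly.

(** * Selections of indices and minors *)

Lemma sel_fun_mono i N (t : selection i N) (a b : 'I_i) :
  (a < b)%N -> (sel_fun t a < sel_fun t b)%N.
Proof. by have /forallP/(_ a)/forallP/(_ b)/implyP := valP t. Qed.

(** Strict growth gives [i <= t i] counting up from 0, and [t i <= i] counting down from the last
    index. *)
Lemma sel_fun_id r (t : selection r r) : sel_fun t =1 id.
Proof.
have lb n (i : 'I_r) : i = n :> nat -> (n <= sel_fun t i)%N.
  elim: n i => // n IHn i def_i; have lt_nr : (n < r)%N.
    by rewrite ltnW // -def_i ltn_ord.
  rewrite (leq_ltn_trans (IHn (Ordinal lt_nr) erefl)) // sel_fun_mono //.
  by rewrite def_i /=.
have ub n (i : 'I_r) : (i + n).+1 = r -> ((sel_fun t i + n).+1 <= r)%N.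
  elim: n i => [|n IHn] i def_r; first by rewrite addn0 ltn_ord.
  have lt_ir : (i.+1 < r)%N by apply: leq_trans (eq_leq def_r); rewrite addnS !ltnS leq_addr.
  apply: leq_trans (IHn (Ordinal lt_ir) _); last by rewrite /= addSn -addnS.
  by rewrite addnS ltnS ltn_add2r sel_fun_mono.
move=> i; apply/val_inj/eqP; rewrite /= eqn_leq (lb i) // andbT.
have def_r : (i + (r - i.+1)).+1 = r by rewrite -addSn subnKC.
by have := ub _ i def_r; rewrite -[X in (_ <= X)%N]def_r ltnS leq_add2r.
Qed.

(** Sorting the values of [phi] yields the permutation; injectivity makes the sorted list strictly
    increasing. *)
Lemma selection_sort i N (phi : 'I_i -> 'I_N) : injective phi ->
  exists (t : selection i N) (s : 'S_i), phi \o s =1 sel_fun t.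
Proof.
move=> inj_phi; pose T := [tuple phi a | a < i].
pose le (x y : 'I_N) := (x <= y)%N.
have [s def_s] : exists s : 'S_i, sort le T = [seq tnth T (s a) | a : 'I_i].
  have /tuple_permP[s def_s] : perm_eq (sort_tuple le T) T by rewrite /= perm_sort.
  by exists s.
have nth_s (a : 'I_i) x : nth x (sort le T) a = phi (s a).
  rewrite def_s (nth_map a) ?size_enum_ord // nth_ord_enum tnth_mktuple //.
have mono_s (a b : 'I_i) : (a < b)%N -> (phi (s a) < phi (s b))%N.
  move=> lt_ab; rewrite ltn_neqAle (inj_eq val_inj) (inj_eq inj_phi).
  rewrite (inj_eq perm_inj) -(inj_eq val_inj) ltn_eqF //=.
  have le_tr : transitive le by move=> x y z; apply: leq_trans.
  have le_tot : total le by move=> x y; apply: leq_total.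
  have := sorted_ltn_nth le_tr (phi a) (sort_sorted le_tot T).
  move=> /(_ a b); rewrite !inE size_sort size_tuple !ltn_ord !nth_s.
  exact.
have sel_s : [forall a : 'I_i, forall b : 'I_i,
    (a < b)%N ==> ([ffun x => phi (s x)] a < [ffun x => phi (s x)] b)%N].
  apply/forallP => a; apply/forallP => b; apply/implyP.
  by rewrite !ffunE; apply: mono_s.
exists (exist _ [ffun x => phi (s x)] sel_s), s => a.
by rewrite /sel_fun /= ffunE.
Qed.

Section Minors.
Variable R : comNzRingType.

Lemma minor_full r l (G : 'M[R]_(l, r)) (s : selection r l) (t : selection r r) :
  minor G s t = \det (rowsub (sel_fun s) G).
Proof.
by congr determinant; apply/matrixP => i j; rewrite !mxE sel_fun_id.
Qed.

(** A repeated row gives determinant 0; otherwise sorting the rows into a selection changes only the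
    sign. *)
Lemma divides_rowsub r l (G : 'M[R]_(l, r)) x :
    (forall s : selection r l, divides x (\det (rowsub (sel_fun s) G))) ->
  forall phi : 'I_r -> 'I_l, divides x (\det (rowsub phi G)).
Proof.
move=> hx phi; have [/injectiveP inj_phi|] := boolP (injectiveb phi); last first.
  case/injectivePn => i [j ne_ij eq_ij].
  rewrite (determinant_alternate ne_ij); first exact: divides0.
  by move=> a; rewrite !mxE eq_ij.
have [t [s def_t]] := selection_sort inj_phi.
have def_sub : rowsub (sel_fun t) G = row_perm s (rowsub phi G).
  by apply/matrixP => i j; rewrite !mxE -def_t.
have := hx t; rewrite def_sub row_permE det_mulmx det_perm => /(divides_mull ((-1) ^+ s)).
by rewrite signrMK.
Qed.

Lemma divides_colsub r m (B : 'M[R]_(r, m)) x :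
    (forall t : selection r m, divides x (\det (colsub (sel_fun t) B))) ->
  forall phi : 'I_r -> 'I_m, divides x (\det (colsub phi B)).
Proof.
move=> hx phi; rewrite -det_tr trmx_mxsub; apply: divides_rowsub => s.
by rewrite -trmx_mxsub det_tr.
Qed.

(** Cauchy-Binet before grouping: the sum runs over all maps, which suffices because
    [divides_rowsub] handles arbitrary maps. *)
Lemma det_mulmx_rowsub r l (Y : 'M[R]_(r, l)) (G : 'M[R]_(l, r)) :
  \det (Y *m G) =
  \sum_(phi : {ffun 'I_r -> 'I_l}) (\prod_i Y i (phi i)) * \det (rowsub phi G).
Proof.
transitivity (\sum_(s : 'S_r) \sum_(phi : {ffun 'I_r -> 'I_l})
    (-1) ^+ s * \prod_i (Y i (phi i) * G (phi i) (s i))).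
  apply: eq_bigr => s _; rewrite -big_distrr /=; congr (_ * _).
  rewrite -(bigA_distr_bigA (fun i j => Y i j * G j (s i))) /=.
  by apply: eq_bigr => i _; rewrite mxE.
rewrite exchange_big; apply: eq_bigr => phi _; rewrite big_distrr /=.
apply: eq_bigr => s _; rewrite mulrCA -big_split /=; congr (_ * _).
by apply: eq_bigr => i _; rewrite !mxE.
Qed.

Lemma divides_row m x (v : 'rV[R]_m) :
  (forall j, divides x (v 0 j)) <-> exists u, v = x *: u.
Proof.
split=> [/fin_all_exists[u def_v]|[u ->] j]; last first.
  by exists (u 0 j); rewrite mxE mulrC.
by exists (\row_j u j); apply/rowP => j; rewrite !mxE def_v mulrC.
Qed.

Lemma row_module_factor p r m (A : 'M[R]_(p, m)) (B : 'M[R]_(r, m)) :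
  (forall i, row_module B (row i A)) -> exists Y, A = Y *m B.
Proof.
move=> /fin_all_exists[Y def_A]; exists (\matrix_i Y i).
by apply/row_matrixP => i; rewrite row_mul rowK def_A.
Qed.

(* McCoy: a bordered minor divisible by [x] whose inner minor is not yields,
   by Laplace expansion along the border, a row vector killed by [B] modulo [x]. *)
Lemma divides_minors_unit r m (B : 'M[R]_(r, m)) x :
    (forall t : selection r m, divides x (\det (colsub (sel_fun t) B))) ->
    (forall (b : 'rV_r) u, b *m B = x *: u -> exists b', b = x *: b') ->
  divides x 1.
Proof.
move=> hx inj_x.
have hx_r (phi : 'I_r -> 'I_r) (psi : 'I_r -> 'I_m) :
    divides x (\det (mxsub phi psi B)).
  rewrite -[B]mul1mx mxsub_mul det_mulmx; apply: divides_mull.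
  exact: divides_colsub.
(* Descending induction on the size [i] of the minor: [n] counts the missing rows, and size 0 gives
   the empty determinant 1. *)
suff: forall n i, (n + i)%N = r ->
    forall (phi : 'I_i -> 'I_r) (psi : 'I_i -> 'I_m),
      divides x (\det (mxsub phi psi B)).
  move=> /(_ r 0%N (addn0 r) (fun i => widen_ord (leq0n r) i)).
  have empty (i : 'I_0) : 'I_m by case: i.
  by move=> /(_ empty); rewrite det_mx00.
elim=> [|n IHn] i def_r phi psi; first by move: phi psi; rewrite -[i]add0n def_r.
have /subsetPn[a0 _ a0phi] : ~~ ('I_r \subset codom phi).
  apply/negP => /subset_leq_card; rewrite card_ord leqNgt.
  rewrite (leq_ltn_trans (card_size _)) // size_codom card_ord -def_r.
  by rewrite addSn ltnS leq_addl.
pose phi' (a : 'I_i.+1) : 'I_r := oapp phi a0 (unlift ord0 a).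
have phi'0 : phi' ord0 = a0 by rewrite /phi' unlift_none.
have phi'S (a : 'I_i) : phi' (lift ord0 a) = phi a by rewrite /phi' liftK.
(* Cofactors along the bordering column do not depend on the column [j] placed there, so a single
   [b] serves every [j]: entry [j] of [b *m B] is the minor bordered by row [a0] and column [j]. *)
pose cof (a : 'I_i.+1) : R := (-1) ^+ a * \det (mxsub (phi' \o lift a) psi B).
pose b := \sum_a cof a *: delta_mx (0 : 'I_1) (phi' a).
have bB j : (b *m B) 0 j = \sum_a cof a * B (phi' a) j.
  rewrite mulmx_suml summxE; apply: eq_bigr => a _.
  by rewrite -scalemxAl -rowE !mxE.
have [u def_u] : exists u, b *m B = x *: u.
  apply/divides_row => j; rewrite bB.
  pose psi' (c : 'I_i.+1) := oapp psi j (unlift ord0 c).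
  have def_r' : (n + i.+1)%N = r by rewrite addnS.
  have := IHn _ def_r' phi' psi'; rewrite (expand_det_col _ ord0).
  congr divides; apply: eq_bigr => a _; rewrite mulrC mxE /psi' unlift_none /=.
  congr (_ * _); rewrite /cofactor addn0; congr (_ * \det _).
  by apply/matrixP => p q; rewrite !mxE /psi' liftK.
(* As [a0] lies outside the image of [phi], entry [a0] of [b] is exactly the inner minor. *)
have /divides_row/(_ a0) := inj_x _ _ def_u.
congr divides; rewrite /b summxE big_ord_recl big1 => [|a _].
  rewrite addr0 !mxE phi'0 !eqxx mulr1 /cof expr0 mul1r; congr determinant.
  by apply/matrixP => p q; rewrite !mxE /= phi'S.
rewrite !mxE phi'S; rewrite eqxx /=; case: eqP => [def_a0|]; last by rewrite mulr0.
by rewrite def_a0 codom_f in a0phi.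
Qed.
End Minors.

(** * Rank over the fraction field *)

Section Rank.
Variable R : idomainType.

Lemma mulmx_rank_frac_eq0 p r m (B : 'M[R]_(r, m)) (A : 'M[R]_(p, r)) :
  rank_frac B = r -> A *m B = 0 -> A = 0.
Proof.
move=> rkB AB0; have freeB : row_free (map_mx (@tofrac R) B) by apply/eqP.
have /matrixP A0 : map_mx (@tofrac R) A = 0.
  by apply: (row_free_inj freeB); rewrite mul0mx -map_mxM AB0 map_mx0.
by apply/matrixP => i j; have /eqP := A0 i j; rewrite !mxE tofrac_eq0 => /eqP.
Qed.

Lemma rank_frac_factorl l r m (G : 'M[R]_(l, r)) (B : 'M[R]_(r, m)) :
  rank_frac (G *m B) = r -> rank_frac B = r.
Proof.
move=> rkGB; apply/eqP; rewrite eqn_leq rank_leq_row /=.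
by rewrite -{1}rkGB /rank_frac map_mxM mxrankM_maxr.
Qed.

(** Divisibility by 0 means vanishing, so [divides_rowsub] would carry it to the invertible row
    submatrix that full column rank supplies over the fraction field. *)
Lemma rank_frac_minor_neq0 l r (A : 'M[R]_(l, r)) :
  rank_frac A = r ->
  ~ (forall s : selection r l, \det (rowsub (sel_fun s) A) = 0).
Proof.
move=> rkA A0; have fullA : row_full (map_mx (@tofrac R) A) by apply/eqP.
have := fullrowsub_unit fullA; rewrite -map_mxsub unitmxE det_map_mx /=.
have [|q ->] := @divides_rowsub _ _ _ A 0 _ (fullrankfun fullA).
  by move=> s; rewrite A0; apply: divides0.
by rewrite mulr0 rmorph0 unitr0.
Qed.

End Rank.

(* The maximal minors of [G] generate the principal ideal [(f)]. *)
Definition minors_generate (R : comNzRingType) (l r : nat) (G : 'M[R]_(l, r)) (f : R) :=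
  exists a c : selection r l -> R, \sum_s a s * c s = 1 /\
    forall s, \det (rowsub (sel_fun s) G) = c s * f.

(** * Matrices whose maximal minors generate a principal ideal *)

Section MinorsGenerate.
Variables (R : comNzRingType) (l r : nat).
Implicit Types (G : 'M[R]_(l, r)) (f x : R).

Lemma divides_minors_generate G f x : minors_generate G f ->
  (forall s : selection r l, divides x (\det (rowsub (sel_fun s) G))) ->
  divides x f.
Proof.
move=> [a [c [ac1 def_G]]] hx; rewrite -[f]mul1r -ac1 mulr_suml.
by apply: divides_sum => s _; rewrite -mulrA; apply: divides_mull; rewrite -def_G.
Qed.

Lemma minors_generate_gcd G f : minors_generate G f -> is_gcd_minors r G f.
Proof.
move=> genG; split=> [x [s [t ->]]|x hx].
  have [a [c [_ def_G]]] := genG.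
  by rewrite minor_full def_G; apply/divides_mull/divides_refl.
apply: divides_minors_generate genG _ => s; apply: hx.
(* The minors in [is_gcd_minors] also carry a column selection; here it is the identity. *)
have id_mono : [forall a : 'I_r, forall b : 'I_r,
    (a < b)%N ==> ([ffun x => x] a < [ffun x => x] b)%N].
  by apply/forallP => a; apply/forallP => b; rewrite !ffunE; apply/implyP.
by exists s, (exist _ [ffun x => x] id_mono); rewrite minor_full.
Qed.

Lemma minors_generate_mul G f (A : 'M[R]_r) :
  minors_generate G f -> minors_generate (G *m A) (f * \det A).
Proof.
move=> [a [c [ac1 def_G]]]; exists a, c; split=> // s.
by rewrite -mul_rowsub_mx det_mulmx def_G mulrA.
Qed.

(** The adjugate inverts each block of [r] rows up to its minor [c s * f]; weighting by the Bezout
    coefficients [a s] makes these add up to [f]. *)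
Lemma minors_generate_linv G f : minors_generate G f ->
  exists X : 'M[R]_(r, l), X *m G = f%:M.
Proof.
move=> [a [c [ac1 def_G]]].
exists (\sum_s a s *: (\adj (rowsub (sel_fun s) G) *m rowsub (sel_fun s) 1%:M)).
rewrite mulmx_suml -[f%:M]scale1r -[X in _ = X *: _]ac1 scaler_suml; apply: eq_bigr => s _.
rewrite -scalemxAl -mulmxA -rowsubE mul_adj_mx def_G.
by rewrite !scale_scalar_mx mulrA.
Qed.

(** For fixed columns [t], the minors of [G *m B] are those of [G] times one minor of [B], and so
    generate the ideal of [f] times that minor. *)
Lemma minors_generate_divides_minor m (G : 'M[R]_(l, r)) (B : 'M[R]_(r, m)) f x :
    minors_generate G f ->
    (forall (s : selection r l) t, divides x (minor (G *m B) s t)) ->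
  forall t : selection r m, divides x (f * \det (colsub (sel_fun t) B)).
Proof.
move=> genG hx t; apply: divides_minors_generate (minors_generate_mul _ genG) _ => s.
by rewrite -mul_rowsub_mx -mxsub_mul; apply: hx.
Qed.

Lemma minors_generate_divides_gcd m (G : 'M[R]_(l, r)) (B : 'M[R]_(r, m)) f d :
  minors_generate G f -> is_gcd_minors r (G *m B) d -> divides f d.
Proof.
move=> [a [c [_ def_G]]] [_]; apply=> _ [s [t ->]].
by rewrite /minor mxsub_mul det_mulmx def_G mulrAC; apply/divides_mull/divides_refl.
Qed.

End MinorsGenerate.

(** * Factorizations and colon modules *)

Section Modules.
Variable R : idomainType.
Hypothesis gcdR : gcd_domain R.

Lemma minors_generate_assoc l r (G : 'M[R]_(l, r)) f f' :
    f' != 0 -> minors_generate G f' -> divides f f' -> divides f' f ->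
  minors_generate G f.
Proof.
move=> f'0 [a [c [ac1 def_G]]] [v def_f'] [w def_f].
have vw1 : v * w = 1.
  by apply: (mulIf f'0); rewrite mul1r -mulrA -def_f -def_f'.
exists (fun s => a s * w), (fun s => c s * v); split=> [|s].
  by rewrite -[RHS]ac1; apply: eq_bigr => s _; rewrite mulrACA [w * v]mulrC vw1 mulr1.
by rewrite def_G {1}def_f' mulrA.
Qed.

Section Factor.
Variables (l m r : nat) (G : 'M[R]_(l, r)) (B : 'M[R]_(r, m)).
Variable c : selection r l -> R.
Hypotheses (hc : column_reduced_minors (G *m B) c)
           (hgen : forall p, ideal_gen c p).

(** On the columns [t] of the reduced minors, a minor of [G] times the minor of [B] equals
    [c s * e]. A Bezout relation among the [c s] shows that [e] is [f] times the minor of [B], which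
    then cancels. *)
Lemma factor_minors_generate : exists2 f, f != 0 & minors_generate G f.
Proof.
have [t [e [rkF _ def_F]]] := hc; have [a ac1] := hgen 1.
have minG s : \det (rowsub (sel_fun s) G) * \det (colsub (sel_fun t) B) = c s * e.
  by rewrite -det_mulmx -mxsub_mul mxsubrc -def_F.
pose f := \sum_s a s * \det (rowsub (sel_fun s) G).
have def_e : e = f * \det (colsub (sel_fun t) B).
  rewrite mulr_suml -[e]mul1r ac1 mulr_suml; apply: eq_bigr => s _.
  by rewrite -!mulrA minG.
have e0 : e != 0.
  apply/eqP => e0; apply: (rank_frac_minor_neq0 rkF) => s.
  by rewrite def_F e0 mulr0.
move: (e0); rewrite def_e mulf_eq0 => /norP[f0 dt0]; exists f => //.
exists a, c; split=> // s; apply: (mulIf dt0).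
by rewrite minG def_e mulrA.
Qed.

Lemma factor_gcd_minors_generate f :
  is_gcd_minors r G f -> f != 0 /\ minors_generate G f.
Proof.
move=> [fG fmax]; have [f' f'0 genG] := factor_minors_generate.
have [f'G f'max] := minors_generate_gcd genG.
have ff' := f'max _ fG; have f'f := fmax _ f'G.
split; last exact: minors_generate_assoc genG ff' f'f.
by apply: contraNneq f'0 => f0; have [q ->] := ff'; rewrite f0 mulr0.
Qed.

Lemma colon_factor f d q :
    minors_generate G f -> f != 0 -> is_gcd_minors r (G *m B) d ->
    d = q * f -> coprime_pair f q ->
  forall u, colon (row_module (G *m B)) f u <-> row_module B u.
Proof.
move=> genG f0 gcd_d def_d cop_fq u; split=> [[a def_u]|[b ->]]; last first.
  have [X XG] := minors_generate_linv genG.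
  by exists (b *m X); rewrite mulmxA -[_ *m G]mulmxA XG mul_mx_scalar scalemxAl.
pose b := a *m G; have {}def_u : f *: u = b *m B by rewrite def_u mulmxA.
(* Multiply [f *: u = b *m B], restricted to the columns [t], by the adjugate of that block of
   [B]. *)
have fb t j : divides f (b 0 j * \det (colsub (sel_fun t) B)).
  have bBt : b *m colsub (sel_fun t) B = f *: colsub (sel_fun t) u.
    by rewrite mulmx_colsub -def_u; apply/rowP => i; rewrite !mxE.
  have /rowP/(_ j) : b *m (\det (colsub (sel_fun t) B))%:M =
      f *: (colsub (sel_fun t) u *m \adj (colsub (sel_fun t) B)).
    by rewrite -mul_mx_adj mulmxA bBt -scalemxAl.
  rewrite mul_mx_scalar [LHS]mxE [RHS]mxE mulrC => ->.
  exact/divides_mulr/divides_refl.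
(* Each minor of [G *m B] is a multiple of [f] times a minor of [B], so [f * f] divides [b 0 j]
   times every one of them, hence [b 0 j * d]. Cancelling one [f] leaves [b 0 j * q], and
   coprimality removes [q]. *)
have [|b' def_b] := (divides_row f b).1.
  move=> j; apply: (coprime_divides gcdR cop_fq).
  apply: (@divides_cancel _ f) => //; rewrite -mulrA -def_d.
  pose ms := [seq minor (G *m B) p.1 p.2 | p : selection r l * selection r m].
  apply: (divides_mul_gcd gcdR (t := ms) _ gcd_d) => [y|y [s [t ->]]].
    split=> [[s [t ->]]|/mapP[[s t] _ ->]]; last by exists s, t.
    by apply/mapP; exists (s, t); rewrite ?mem_enum.
  have [_ [c' [_ def_G]]] := genG.
  rewrite /minor mxsub_mul det_mulmx def_G -mulrA mulrCA [b 0 j * _]mulrCA.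
  by apply/divides_mull/divides_mul; [apply: divides_refl | apply: fb].
exists b'; apply/rowP => j; apply: (mulfI f0).
by move/rowP/(_ j): def_u; rewrite def_b -scalemxAl !mxE.
Qed.

Lemma colon_factor_unit f d g :
    minors_generate G f -> f != 0 -> is_gcd_minors r (G *m B) d ->
    divides (g * f) d -> rank_frac B = r ->
    (forall u, colon (row_module (G *m B)) (g * f) u -> row_module B u) ->
  divides g 1.
Proof.
move=> genG f0 [dF _] gf_d rkB colonB.
apply: (@divides_minors_unit _ _ _ B) => [t|b u bB].
  apply: (divides_cancel f0); rewrite [X in divides _ X]mulrC.
  apply: minors_generate_divides_minor genG _ t => s t.
  by apply: divides_trans gf_d _; apply: dF; exists s, t.
(* The row [b *m X] witnesses that [g * f] times [u] lies in the row module of [G *m B], since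
   [b *m X *m G = f *: b]. *)
have [X XG] := minors_generate_linv genG.
have [|b' def_u] := colonB u.
  exists (b *m X); rewrite mulmxA -[_ *m G]mulmxA XG mul_mx_scalar.
  by rewrite -scalemxAl bB scalerA mulrC.
exists b'; apply/eqP; rewrite -subr_eq0; apply/eqP.
by apply: mulmx_rank_frac_eq0 rkB _; rewrite mulmxBl bB def_u scalemxAl subrr.
Qed.

End Factor.

(** While the exponent exceeds 1, [x] divides a power of [f] times [f] and the same power times [q];
    coprimality of [f] and [q] lowers the exponent by one. *)
Lemma divides_expn_coprime (x f q : R) j :
  coprime_pair f q -> divides x (f ^+ j.+1) -> divides x (q * f) -> divides x f.
Proof.
move=> cop_fq; elim: j => // j IHj xf xqf; apply: IHj => //.
rewrite -[_ ^+ _]mulr1; apply: divides_mul_gcd2 cop_fq _ _ => //.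
  by rewrite -exprSr.
by rewrite exprSr -mulrA [f * q]mulrC; apply: divides_mull.
Qed.

End Modules.

(** * The equivalence *)

Lemma row_row_module (R : comNzRingType) l m (F : 'M[R]_(l, m)) i :
  row_module F (row i F).
Proof. by exists (delta_mx 0 i); rewrite -rowE. Qed.

Lemma row_module_scale (R : comNzRingType) l m (F : 'M[R]_(l, m)) x u :
  row_module F u -> row_module F (x *: u).
Proof. by move=> [a ->]; exists (x *: a); rewrite scalemxAl. Qed.

Theorem theorem25 (k : closedFieldType) (n l m r : nat)
    (hn : (3 <= n)%N) (hlm : (l <= m)%N)
    (F : 'M[{mpoly k[n]}]_(l, m))
    (hF : rank_frac F = r) (hr : (1 <= r < l)%N)
    (c : selection r l -> {mpoly k[n]})
    (hc : column_reduced_minors F c)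
    (d f : {mpoly k[n]})
    (hd : is_gcd_minors r F d) (hf : divides f d)
    (hM : forall h q : {mpoly k[n]},
        M_set d f h -> d = q * h -> coprime_pair h q)
    (hgen : forall p : {mpoly k[n]}, ideal_gen c p) :
  has_FLP_factorization r F f <->
  (free_of_rank (colon (row_module F) f) r /\
   forall h : {mpoly k[n]}, M_set d f h -> ~ associated h f ->
     ~ free_of_rank (colon (row_module F) h) r).
Proof.
have gcdR := @gcd_domain_mpoly k n.
have [q def_d] := hf.
have cop_fq : coprime_pair f q by apply: hM => //; split=> //; apply: divides_refl.
split=> [[G [F1 [[def_F gcdG] [rkF1 FLP]]]]|[[B [_ defB]] not_free]].
  subst F; have [f0 genG] := factor_gcd_minors_generate hc hgen gcdG.
  have colon_f := colon_factor gcdR genG f0 hd def_d cop_fq.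
  split=> [|h [[g def_h] hd'] not_assoc [B [_ defB]]].
    by exists F1; split=> // a; apply: mulmx_rank_frac_eq0.
  (* Since [h] is a multiple of [f], [K : f] is contained in [K : h]. The FLP property makes [A]
     invertible, so both modules equal the row module of [F1], which forces [g] to be a unit. *)
  apply: not_assoc; have [A def_F1] : exists A, F1 = A *m B.
    apply: row_module_factor => i; apply/defB.
    have /colon_f := row_row_module F1 i; rewrite /colon def_h -scalerA.
    exact: row_module_scale.
  have unitA : A \in unitmx.
    have [a a0 def_a] := FLP _ _ def_F1.
    by rewrite unitmxE def_a rmorph_unit // unitfE.
  have [|a a0 def_g] := @mpoly_divides1 k n g; last first.
    by exists a; rewrite // def_h def_g mul_mpolyC.
  apply: colon_factor_unit genG f0 hd _ rkF1 _; rewrite -?def_h // => u.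
  by move=> /defB[y ->]; exists (y *m invmx A); rewrite def_F1 mulmxA mulmxKV.
have [G def_F] : exists G, F = G *m B.
  apply: row_module_factor => i; apply/defB.
  exact/row_module_scale/row_row_module.
subst F; have rkB := rank_frac_factorl hF.
have [f' f'0 genG] := factor_minors_generate hc hgen.
(* The rows of [B] lie in [K : f], so [f *: B] factors through [G *m B]; full row rank cancels
   [B]. *)
have [Y YG] : exists Y, Y *m G = f%:M.
  have [Y def_fB] : exists Y, f *: B = Y *m (G *m B).
    by apply: row_module_factor => i; rewrite linearZ; apply/defB/row_row_module.
  exists Y; apply/eqP; rewrite -subr_eq0; apply/eqP.
  apply: mulmx_rank_frac_eq0 rkB _.
  by rewrite mulmxBl mul_scalar_mx def_fB mulmxA subrr.
(* Taking determinants in [Y *m G = f%:M] shows that [f'] divides [f ^+ r]; as it also divides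
   [d = q * f], coprimality brings the power down to [f]. The exponent is written as the successor
   of [r.-1]. *)
have [g def_f] : divides f' f.
  apply: (@divides_expn_coprime _ gcdR f' f q r.-1) => //; last first.
    by rewrite -def_d; apply: minors_generate_divides_gcd genG hd.
  have [r_gt0 _] := andP hr; rewrite prednK // -det_scalar -YG det_mulmx_rowsub.
  apply: divides_sum => phi _; apply/divides_mull/divides_rowsub => s.
  by have [_ [b [_ ->]]] := genG; apply/divides_mull/divides_refl.
(* Here [K : (g * f')] is [K : f], the row module of [B], so [g] is a unit. *)
have ff' : divides f f'.
  rewrite def_f -[X in divides _ X]mul1r; apply: divides_mul (divides_refl _).
  apply: colon_factor_unit genG f'0 hd _ rkB _; rewrite -def_f // => u.
  by move/defB.
have {}genG : minors_generate G f.
  by apply: minors_generate_assoc genG ff' _ => //; exists g.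
have f0 : f != 0.
  by have [v def_f'] := ff'; apply: contraNneq f'0 => f0; rewrite def_f' f0 mulr0.
exists G, B; split; first by split=> //; apply: minors_generate_gcd.
(* The minors of [G *m A] generate the ideal of [f * \det A], a member of [M(f)], so the colon
   module at this element is the row module of [B'], free of rank [r]. Then [not_free] makes it
   associated to [f], and [\det A] is constant. *)
split=> // A B' def_B; subst B; rewrite mulmxA in hF hc hd not_free.
have genGA := minors_generate_mul A genG.
have [h0 _] := factor_gcd_minors_generate hc hgen (minors_generate_gcd genGA).
have [q' def_d'] := minors_generate_divides_gcd genGA hd.
have Mh : M_set d f (f * \det A).
  by split; [apply/divides_mulr/divides_refl | exists q'].
have [def_A|not_const] := eqVneq (\det A) ((\det A)@_0)%:MP.
  exists (\det A)@_0 => //; apply: contraNneq h0 => a0.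
  by rewrite def_A a0 mpolyC0 mulr0.
case: (not_free _ Mh) => [[a a0 def_h]|].
  case/eqP: not_const; have -> : \det A = a%:MP.
    by apply: (mulfI f0); rewrite def_h mulrC mul_mpolyC.
  by rewrite mcoeffC eqxx mulr1.
exists B'; split=> [b|u].
  by apply: mulmx_rank_frac_eq0; apply: rank_frac_factorl hF.
exact: colon_factor genGA h0 hd def_d' (hM _ _ Mh def_d') u.
Qed.
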